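(* A formula $\alpha\in\mathrm{Form}$ is provable in $\mathcal{L}_\Delta$ if, and only if, it is a tautology; that is, $\emptyset^\vdash=\emptyset^\models$.
   Context: Formulas: $\mathrm{Form}$ is the least set containing a fixed countably infinite set of propositional variables and closed under $\alpha\to\beta$, $\neg\alpha$, and $\delta(\langle\alpha_i\rangle)$ for every sequence $\langle\alpha_i\rangle=\alpha_1,\alpha_2,\dots$ indexed by $\omega$. Notation: $\langle\alpha\rangle$ is the constant sequence of value $\alpha$; $\alpha,\langle\beta_i\rangle$ is $\alpha,\beta_1,\beta_2,\dots$; $\langle\alpha_i\rangle_{i>1}$ is $\alpha_2,\alpha_3,\dots$; $\tfrac12\alpha:=\delta(\alpha,\langle\neg(\alpha\to\alpha)\rangle)$; a schema $\alpha\leftrightarrow\beta$ stands for the two schemas $\alpha\to\beta$ and $\beta\to\alpha$. The calculus $\mathcal{L}_\Delta$ has axiom schemata: (Ł1) $\alpha\to(\beta\to\alpha)$; (Ł2) $(\alpha\to\beta)\to((\beta\to\gamma)\to(\alpha\to\gamma))$; (Ł3) $((\alpha\to\beta)\to\beta)\to((\beta\to\alpha)\to\alpha)$; (Ł4) $(\neg\alpha\to\neg\beta)\to(\beta\to\alpha)$; (Δ1) $\neg(\delta(\langle\alpha_i\rangle)\to\tfrac12\alpha_1)\leftrightarrow\tfrac12\delta(\langle\alpha_i\rangle_{i>1})$; (Δ2) $\tfrac12\delta(\langle\alpha_i\rangle)\leftrightarrow\delta(\langle\tfrac12\alpha_i\rangle)$; (Δ3) $\delta(\langle\alpha\rangle)\leftrightarrow\alpha$;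 (Δ4) $\tfrac12\delta(\langle\alpha_i\rangle)\leftrightarrow\delta(\neg(\alpha\to\alpha),\langle\alpha_i\rangle)$; (Δ5) $\delta(\langle\alpha_i\rangle)\to\delta(\langle\neg\alpha_i\to\beta_i\rangle)$; (Δ6) $\tfrac12\neg(\alpha\to\beta)\leftrightarrow\neg(\tfrac12\alpha\to\tfrac12\beta)$; (Δ7) $\delta(\langle\alpha_i\to\beta_i\rangle)\to(\delta(\langle\alpha_i\rangle)\to\delta(\langle\beta_i\rangle))$. Rules: Modus Ponens and the $\delta$-rule (from $\alpha_i$ for all $i\in\omega$ infer $\delta(\langle\alpha_i\rangle)$). A proof of $\alpha$ from $\Theta$ is a sequence $(\alpha_i)_{i\in\eta+1}$ indexed by a successor ordinal with $\eta$ countable, $\alpha_\eta=\alpha$, each member an axiom, an element of $\Theta$, or obtained from earlier members by a rule. $\Theta^\vdash$ is the set of formulas provable from $\Theta$. Semantics: a valuation is a map $f\colon\mathrm{Form}\to[0,1]$ with $f(\neg\alpha)=1-f(\alpha)$, $f(\alpha\to\beta)=\min\{1,1-f(\alpha)+f(\beta)\}$, $f(\delta(\langle\alpha_i\rangle))=\sum_{i\ge1}f(\alpha_i)/2^i$. $f$ satisfies $\alpha$ if $f(\alpha)=1$. $\Theta^\models$ is the set of formulas satisfied by every valuation satisfying all of $\Theta$; tautologies are the elements of $\emptyset^\models$. *)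

(* Defs.v *)
From Stdlib Require Import Reals.
Open Scope R_scope.

(* Formulas: variables indexed by nat; delta takes an omega-sequence,
   represented as nat -> Form with index 0 standing for alpha_1. *)
Inductive Form : Type :=
| Var : nat -> Form
| Imp : Form -> Form -> Form
| Neg : Form -> Form
| Delta : (nat -> Form) -> Form.

Definition cst (a : Form) : nat -> Form := fun _ => a.
Definition scons (a : Form) (s : nat -> Form) : nat -> Form :=
  fun k => match k with O => a | S k' => s k' end.
Definition stail (s : nat -> Form) : nat -> Form := fun k => s (S k).

Definition bot_of (a : Form) : Form := Neg (Imp a a).
Definition half (a : Form) : Form := Delta (scons a (cst (bot_of a))).

(* Axiom schemata of L_Delta; each "<->" schema gives two constructors. *)
Inductive LAxiom : Form -> Prop :=
| L1 a b : LAxiom (Imp a (Imp b a))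
| L2 a b c : LAxiom (Imp (Imp a b) (Imp (Imp b c) (Imp a c)))
| L3 a b : LAxiom (Imp (Imp (Imp a b) b) (Imp (Imp b a) a))
| L4 a b : LAxiom (Imp (Imp (Neg a) (Neg b)) (Imp b a))
| D1a s : LAxiom (Imp (Neg (Imp (Delta s) (half (s O)))) (half (Delta (stail s))))
| D1b s : LAxiom (Imp (half (Delta (stail s))) (Neg (Imp (Delta s) (half (s O)))))
| D2a s : LAxiom (Imp (half (Delta s)) (Delta (fun i => half (s i))))
| D2b s : LAxiom (Imp (Delta (fun i => half (s i))) (half (Delta s)))
| D3a a : LAxiom (Imp (Delta (cst a)) a)
| D3b a : LAxiom (Imp a (Delta (cst a)))
| D4a a s : LAxiom (Imp (half (Delta s)) (Delta (scons (bot_of a) s)))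
| D4b a s : LAxiom (Imp (Delta (scons (bot_of a) s)) (half (Delta s)))
| D5 s t : LAxiom (Imp (Delta s) (Delta (fun i => Imp (Neg (s i)) (t i))))
| D6a a b : LAxiom (Imp (half (Neg (Imp a b))) (Neg (Imp (half a) (half b))))
| D6b a b : LAxiom (Imp (Neg (Imp (half a) (half b))) (half (Neg (Imp a b))))
| D7 s t : LAxiom (Imp (Delta (fun i => Imp (s i) (t i)))
                       (Imp (Delta s) (Delta t))).

(* A proof of [a] from [Th]: a sequence indexed by a countable successor
   ordinal, presented as a countable well-ordered index type [I] (strict
   order [lt]) with a greatest element [top], labelled by [seq]. *)
Definition is_proof (Th : Form -> Prop) (a : Form)
  (I : Type) (lt : I -> I -> Prop) (top : I) (seq : I -> Form) : Prop :=
  well_founded lt /\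
  (forall i j k, lt i j -> lt j k -> lt i k) /\
  (forall i j, lt i j \/ i = j \/ lt j i) /\
  (exists f : I -> nat, forall i j, f i = f j -> i = j) /\
  (forall i, i <> top -> lt i top) /\
  seq top = a /\
  (forall i,
     LAxiom (seq i) \/ Th (seq i) \/
     (exists j k, lt j i /\ lt k i /\ seq k = Imp (seq j) (seq i)) \/
     (exists s, seq i = Delta s /\
        forall n, exists j, lt j i /\ seq j = s n)).

Definition provable (Th : Form -> Prop) (a : Form) : Prop :=
  exists (I : Type) (lt : I -> I -> Prop) (top : I) (seq : I -> Form),
    is_proof Th a I lt top seq.

Definition is_valuation (v : Form -> R) : Prop :=
  (forall a, 0 <= v a <= 1) /\
  (forall a, v (Neg a) = 1 - v a) /\
  (forall a b, v (Imp a b) = Rmin 1 (1 - v a + v b)) /\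
  (forall s, infinite_sum (fun k => v (s k) / 2 ^ (S k)) (v (Delta s))).

Definition entails (Th : Form -> Prop) (a : Form) : Prop :=
  forall v, is_valuation v -> (forall b, Th b -> v b = 1) -> v a = 1.

Definition tautology (a : Form) : Prop := entails (fun _ => False) a.

(* Main.v *)
(* Every delta-algebra is separated by its homomorphisms to [0,1]; completeness
   is this fact for the Lindenbaum algebra of provably equivalent formulas.

   Suppose [a <> 1] and put [x := ~a]. If all multiples [n x] lay below [~x],
   then [y := delta (2x, 4x, 8x, ...)] would satisfy [x (+) y = y <= ~x],
   whence [x = 0]; so [n x -> a] differs from [1] for some [n], and Zorn's
   lemma gives a prime filter [F] omitting it. The elements [k / 2^n] (the [k]-th
   multiple of the [n]-fold half of [1]) form a copy of the dyadics, and
   [v b := sup {k / 2^n | (k / 2^n -> b) in F}] preserves implication and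
   negation. Since [F] contains [a -> n x], [v a <= n (1 - v a)], so [v a < 1].
   Finally [v] preserves delta automatically: the axioms force
   [v (delta s) = v (s 0) / 2 + v (delta (tail s)) / 2], and iterating gives the
   series. *)

From Stdlib Require Import Reals Lra Lia Classical ClassicalEpsilon
  FunctionalExtensionality PropExtensionality Cantor Relation_Operators
  Lexicographic_Product Eqdep_dec.
From Coquelicot Require Import Coquelicot.
From mathcomp Require classical_sets.
Require Import Defs.
Set Bullet Behavior "Strict Subproofs".

(** * Delta-algebras *)

(** [halve] is a separate operation tied down by [halveE], with the fixed zero [neg one] in the
    tail. In formulas the tail of [half a] is [bot_of a], which varies with [a] and agrees with the
    zero only up to provable equivalence. *)
Record delta_algebra : Type := {
  carrier :> Type;
  imp : carrier -> carrier -> carrier;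
  neg : carrier -> carrier;
  one : carrier;
  delta : (nat -> carrier) -> carrier;
  halve : carrier -> carrier;
  imp_mp : forall x, imp one x = one -> x = one;
  imp_antisym : forall x y, imp x y = one -> imp y x = one -> x = y;
  imp_const : forall x y, imp x (imp y x) = one;
  imp_comp : forall x y z, imp (imp x y) (imp (imp y z) (imp x z)) = one;
  imp_join : forall x y, imp (imp (imp x y) y) (imp (imp y x) x) = one;
  imp_contra : forall x y, imp (imp (neg x) (neg y)) (imp y x) = one;
  halveE : forall x,
    halve x = delta (fun k => match k with O => x | S _ => neg one end);
  delta_tail : forall s,
    neg (imp (delta s) (halve (s O))) = halve (delta (fun k => s (S k)));
  delta_halve : forall s, halve (delta s) = delta (fun k => halve (s k));
  delta_const : forall x, delta (fun _ => x) = x;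
  halve_diff : forall x y, halve (neg (imp x y)) = neg (imp (halve x) (halve y));
  delta_imp : forall s t,
    imp (delta (fun k => imp (s k) (t k))) (imp (delta s) (delta t)) = one
}.

Arguments imp {_}.
Arguments neg {_}.
Arguments one {_}.
Arguments delta {_}.
Arguments halve {_}.

Declare Scope delta_scope.
Delimit Scope delta_scope with D.
Notation "x ~> y" := (imp x y) (at level 60, right associativity) : delta_scope.
Notation "~~ x" := (neg x) (at level 35, right associativity) : delta_scope.
Notation "x <<= y" := (imp x y = one) (at level 70, no associativity) : delta_scope.
(** In [0,1] this is truncated addition min(1, x + y); likewise [~~ (x ~> y)] is truncated
    subtraction max(0, x - y). *)
Notation "x (+) y" := (imp (neg x) y) (at level 50, left associativity) : delta_scope.

(** * Arithmetic of Wajsberg algebras *)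

Section Wajsberg.
Context {A : delta_algebra}.
Open Scope delta_scope.
Implicit Types x y z : A.

Lemma le_one x : x <<= one.
Proof. apply imp_mp, imp_const. Qed.

Lemma imp_one_l x : one ~> x = x.
Proof.
  apply imp_antisym; [| apply imp_const].
  generalize (imp_join A x one). rewrite !le_one. apply imp_mp.
Qed.

Lemma le_refl x : x <<= x.
Proof. generalize (imp_const A x one). rewrite imp_one_l. trivial. Qed.

Lemma le_trans x y z : x <<= y -> y <<= z -> x <<= z.
Proof.
  intros Hxy Hyz. generalize (imp_comp A x y z).
  rewrite Hxy, Hyz, !imp_one_l. trivial.
Qed.

(** Both sides are the join of [x] and [y]; in [0,1] they are max(x, y). *)
Lemma imp_joinC x y : (x ~> y) ~> y = (y ~> x) ~> x.
Proof. apply imp_antisym; apply imp_join. Qed.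

Lemma imp_anti_l x y z : x <<= y -> (y ~> z) <<= (x ~> z).
Proof. intros H. generalize (imp_comp A x y z). rewrite H, imp_one_l. trivial. Qed.

Lemma le_join_l x y : x <<= ((x ~> y) ~> y).
Proof. rewrite imp_joinC. apply imp_const. Qed.

Lemma imp_exchange_le x y z : (x ~> y ~> z) <<= (y ~> x ~> z).
Proof.
  apply le_trans with (((y ~> z) ~> z) ~> (x ~> z)); [apply imp_comp |].
  apply imp_anti_l, le_join_l.
Qed.

Lemma imp_exchange x y z : x ~> y ~> z = y ~> x ~> z.
Proof. apply imp_antisym; apply imp_exchange_le. Qed.

Lemma imp_comp_r x y z : (y ~> z) <<= ((x ~> y) ~> (x ~> z)).
Proof. rewrite imp_exchange. apply imp_comp. Qed.

Lemma neg_one_le x : ~~ one <<= x.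
Proof.
  apply le_trans with (~~ x ~> ~~ one); [apply imp_const |].
  rewrite <- (imp_one_l x) at 2. apply imp_contra.
Qed.

(** Weakening puts the premise [~~ ~~ one] in front; contraposing twice then ends at [one ~> x]. *)
Lemma negK_le x : ~~ ~~ x <<= x.
Proof.
  apply le_trans with (~~ ~~ one ~> ~~ ~~ x); [apply imp_const |].
  apply le_trans with (~~ x ~> ~~ one); [apply imp_contra |].
  rewrite <- (imp_one_l x) at 2. apply imp_contra.
Qed.

Lemma negK x : ~~ ~~ x = x.
Proof.
  apply imp_antisym; [apply negK_le |].
  generalize (imp_contra A (~~ ~~ x) x). rewrite negK_le. apply imp_mp.
Qed.

Lemma contra x y : ~~ x ~> ~~ y = y ~> x.
Proof.
  apply imp_antisym; [apply imp_contra |].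
  rewrite <- (negK x) at 1. rewrite <- (negK y) at 1. apply imp_contra.
Qed.

Lemma negE x : ~~ x = x ~> ~~ one.
Proof. rewrite <- (negK x) at 2. rewrite contra, imp_one_l. reflexivity. Qed.

Lemma addC x y : x (+) y = y (+) x.
Proof. rewrite <- (negK y) at 1. apply contra. Qed.

Lemma addA x y z : x (+) (y (+) z) = (x (+) y) (+) z.
Proof.
  rewrite (addC y z), (addC (x (+) y) z). apply imp_exchange.
Qed.

Lemma add0 x : ~~ one (+) x = x.
Proof. rewrite negK. apply imp_one_l. Qed.

Lemma imp_add x y : x ~> y = ~~ x (+) y.
Proof. rewrite negK. reflexivity. Qed.

Lemma le_add_r x y : y <<= x (+) y.
Proof. apply imp_const. Qed.

(** Adding [y] back to the difference gives the join of [x] and [y], which is [x]. *)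
Lemma subK x y : y <<= x -> ~~ (x ~> y) (+) y = x.
Proof. intros H. rewrite negK, imp_joinC, H. apply imp_one_l. Qed.

(** The hypothesis says that the sum is not truncated, so subtracting [y] recovers [x]. *)
Lemma addK x y : x <<= ~~ y -> ~~ ((x (+) y) ~> y) = x.
Proof.
  intros H. rewrite imp_joinC.
  rewrite <- contra, negK in H. rewrite H, imp_one_l. apply negK.
Qed.

(** With [s := x ~> y], the element [y ~> x] equals [(s ~> y) ~> x]. On the left side the premises
    [s] and [s ~> y] together amount to the meet of [s] and [y], which is [y] because [y <<= s]. *)
Lemma prelinear x y : (x ~> y) ~> (y ~> x) = y ~> x.
Proof.
  assert (E : y ~> x = ((x ~> y) ~> y) ~> x).
  { apply imp_antisym.
    - rewrite imp_joinC. apply le_join_l.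
    - apply imp_anti_l. apply imp_const. }
  rewrite E at 1. set (s := x ~> y) in *.
  assert (Hs : y <<= s) by apply imp_const.
  rewrite <- (contra x (s ~> y)), imp_exchange.
  rewrite <- (negK s) at 1. rewrite contra.
  rewrite <- (contra y s), imp_joinC, contra, Hs, imp_one_l.
  apply contra.
Qed.

Fixpoint mul (n : nat) x : A :=
  match n with O => ~~ one | S n' => x (+) mul n' x end.

Lemma mulD m n x : mul (m + n) x = mul m x (+) mul n x.
Proof.
  induction m as [|m IH]; cbn.
  - rewrite add0. reflexivity.
  - rewrite IH. apply addA.
Qed.

Lemma mulM m n x : mul (m * n) x = mul m (mul n x).
Proof.
  induction m as [|m IH]; cbn; [reflexivity |].
  rewrite mulD, IH. reflexivity.
Qed.

Lemma mul1 x : mul 1 x = x.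
Proof. cbn. rewrite addC. apply add0. Qed.

Lemma mul_le m n x : (m <= n)%nat -> mul m x <<= mul n x.
Proof.
  intros H. replace n with ((n - m) + m)%nat by lia. rewrite mulD. apply le_add_r.
Qed.

End Wajsberg.

(** * Halving and the Archimedean property *)

Section Delta.
Context {A : delta_algebra}.
Open Scope delta_scope.
Implicit Types x y z : A.

Lemma delta_mono (s t : nat -> A) : (forall k, s k <<= t k) -> delta s <<= delta t.
Proof.
  intros H. generalize (delta_imp A s t).
  replace (fun k => s k ~> t k) with (fun _ : nat => one : A).
  - rewrite delta_const, imp_one_l. trivial.
  - extensionality k. symmetry. apply H.
Qed.

Lemma halve_le_delta (s : nat -> A) : halve (s O) <<= delta s.
Proof.
  rewrite halveE. apply delta_mono. intros [|k]; [apply le_refl | apply neg_one_le].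
Qed.

Lemma halve_le x : halve x <<= x.
Proof.
  rewrite <- (delta_const A x) at 2. apply (halve_le_delta (fun _ => x)).
Qed.

Lemma halve_mono x y : x <<= y -> halve x <<= halve y.
Proof.
  intros H. rewrite !halveE. apply delta_mono. intros [|k]; [exact H | apply le_refl].
Qed.

(** This is the tail law for a constant sequence, which equals its own tail. *)
Lemma sub_halve x : ~~ (x ~> halve x) = halve x.
Proof.
  generalize (delta_tail A (fun _ => x)). rewrite delta_const. trivial.
Qed.

Lemma halve_add x : halve x (+) halve x = x.
Proof.
  rewrite <- (sub_halve x) at 1. apply subK, halve_le.
Qed.

(** Without truncation, [x] is the difference of [x (+) x] and [x]. Halving preserves differences,
    so half of the double is [halve x (+) halve x]. *)
Lemma halve_double x : x <<= ~~ x -> halve (x (+) x) = x.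
Proof.
  intros H.
  assert (E := halve_diff A (x (+) x) x). rewrite addK in E by exact H.
  rewrite <- (subK (halve (x (+) x)) (halve x)).
  - rewrite <- E. apply halve_add.
  - apply halve_mono, le_add_r.
Qed.

(* With [y] the value of [delta] at [2x, 4x, 8x, ...], peeling off the first
   term gives [x (+) y = y], which forces [x = 0] because [y <= ~~ x]. *)
Lemma archimedean x : (forall n, mul n x <<= ~~ x) -> x = ~~ one.
Proof.
  intros H.
  (* Moving the summands across one at a time shows that no sum of two multiples of [x] is
     truncated. Hence each doubling in [p] is undone exactly by [halve]. *)
  assert (Hsmall : forall n m, mul m x <<= ~~ mul n x).
  { induction n as [|n IH]; intros m.
    - cbn. rewrite negK. apply le_one.
    - cbn [mul]. rewrite addC, <- (addK (mul m x) x) by apply H.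
      rewrite contra. apply imp_anti_l. rewrite addC. apply (IH (S m)). }
  set (p := fun k => mul (2 ^ S k) x).
  assert (Hp : forall k, halve (p k) = mul (2 ^ k) x).
  { intros k. unfold p. replace (2 ^ S k)%nat with (2 ^ k + 2 ^ k)%nat by (cbn; lia).
    rewrite mulD. apply halve_double, Hsmall. }
  assert (Hx : halve (p O) = x) by (rewrite Hp; apply mul1).
  assert (Hxy : x <<= delta p) by (rewrite <- Hx at 1; apply halve_le_delta).
  assert (Hyx : delta p <<= ~~ x).
  { rewrite <- (delta_const A (~~ x)). apply delta_mono. intros k. apply H. }
  assert (E : x (+) delta p = delta p).
  { assert (E := delta_tail A p). rewrite Hx, delta_halve in E.
    (* Halving the tail of [p] term by term gives [p] back. *)
    replace (fun k => halve (p (S k))) with p in E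
      by (extensionality k; rewrite Hp; reflexivity).
    rewrite addC, <- E at 1. apply subK, Hxy. }
  rewrite <- (addK x (delta p)) at 1.
  - rewrite E, le_refl. reflexivity.
  - rewrite <- contra, negK. exact Hyx.
Qed.

End Delta.
(** * Prime filters *)

Section Filters.
Context {A : delta_algebra}.
Open Scope delta_scope.
Implicit Types x y z : A.

Definition is_filter (F : A -> Prop) : Prop :=
  F one /\ forall x y, F x -> F (x ~> y) -> F y.

Lemma filter_up F x y : is_filter F -> x <<= y -> F x -> F y.
Proof. intros [F1 Fmp] H Hx. apply Fmp with x; [exact Hx |]. rewrite H. exact F1. Qed.

Lemma filter_trans F x y z : is_filter F -> F (x ~> y) -> F (y ~> z) -> F (x ~> z).
Proof.
  intros HF Hxy Hyz. apply (proj2 HF) with (y ~> z); [exact Hyz |].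
  revert Hxy. apply filter_up; [exact HF | apply imp_comp].
Qed.

(** The curried form of [x^n ~> y], where the power is taken for strong conjunction. *)
Fixpoint impn (n : nat) x y : A :=
  match n with O => y | S n' => impn n' x (x ~> y) end.

Lemma impn_imp n x y z : impn n x (y ~> z) = y ~> impn n x z.
Proof.
  revert z. induction n as [|n IH]; intros z; cbn; [reflexivity |].
  rewrite imp_exchange. apply IH.
Qed.

Lemma impnD m n x y : impn (m + n) x y = impn m x (impn n x y).
Proof.
  revert y. induction m as [|m IH]; intros y; cbn; [reflexivity |].
  rewrite IH, impn_imp. reflexivity.
Qed.

Lemma impn_comp n x y z : (y ~> z) <<= (impn n x y ~> impn n x z).
Proof.
  revert y z. induction n as [|n IH]; intros y z; cbn; [apply le_refl |].
  apply le_trans with ((x ~> y) ~> (x ~> z)); [apply imp_comp_r | apply IH].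
Qed.

Lemma impn_mono n x y z : y <<= z -> impn n x y <<= impn n x z.
Proof.
  intros H. generalize (impn_comp n x y z). rewrite H, imp_one_l. trivial.
Qed.

(** The filter generated by [F] and [x], in the form given by the local deduction theorem: [x] may
    be used any finite number of times. *)
Definition adjoin (F : A -> Prop) x y : Prop := exists n, F (impn n x y).

Lemma adjoin_filter F x : is_filter F -> is_filter (adjoin F x).
Proof.
  intros HF. split.
  - exists O. apply HF.
  - intros y z [n Hy] [m Hz]. exists (m + n)%nat.
    rewrite impnD. apply (proj2 HF) with (impn n x y); [exact Hy |].
    rewrite <- impn_imp. revert Hz.
    apply filter_up; [exact HF | apply impn_mono, impn_comp].
Qed.

(** The join of [x] and [y] is [one]. So [x ~> z] in [F] puts the join of [z] and [y] in [F];
    written as [(y ~> z) ~> z], it yields [z] by detaching [y ~> z]. *)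
Lemma filter_join F x y z :
  is_filter F -> (x ~> y) ~> y = one -> F (x ~> z) -> F (y ~> z) -> F z.
Proof.
  intros HF Hxy Hx Hy.
  apply (proj2 HF) with (y ~> z); [exact Hy |]. rewrite imp_joinC.
  rewrite <- (imp_one_l ((z ~> y) ~> y)), <- Hxy.
  revert Hx. apply filter_up; [exact HF |].
  apply le_trans with ((z ~> y) ~> (x ~> y)); apply imp_comp.
Qed.

(** Induction on the total number of premises: [filter_join] replaces the goal [z] by [x ~> z] and
    [y ~> z], and each of these absorbs one premise. *)
Lemma filter_join_impn F x y m n z :
  is_filter F -> (x ~> y) ~> y = one ->
  F (impn m x z) -> F (impn n y z) -> F z.
Proof.
  intros HF Hxy.
  remember (m + n)%nat as k eqn:Ek.
  assert (Hk : (m + n <= k)%nat) by lia. clear Ek.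
  revert m n z Hk. induction k as [|k IH]; intros [|m] [|n] z Hk Hx Hy;
    try exact Hx; try exact Hy; try lia.
  apply (filter_join F x y); [exact HF | exact Hxy | |].
  - apply (IH m (S n)); [lia | exact Hx |].
    revert Hy. apply filter_up; [exact HF | apply impn_mono, imp_const].
  - apply (IH (S m) n); [lia | | exact Hy].
    revert Hx. apply filter_up; [exact HF | apply impn_mono, imp_const].
Qed.

(* [Zorn_bigcup] also asks for the union of the empty chain, which is not a filter. *)
Definition with_one (X : A -> Prop) x : Prop := x = one \/ X x.

(** A filter maximal among those omitting [g] is prime. If it contained neither [x ~> y] nor
    [y ~> x], adjoining either one would produce [g]; their join is [one] by prelinearity, so [g]
    would already be a member. *)
Lemma prime_filter_exists (g : A) :
  g <> one ->
  exists F, is_filter F /\ ~ F g /\ forall x y, F (x ~> y) \/ F (y ~> x).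
Proof.
  intros Hg.
  destruct (@classical_sets.Zorn_bigcup A
    (fun X => is_filter (with_one X) /\ ~ X g)) as [X [[HF HX] Hmax]].
  - intros C HC Htot. split; [split |].
    + left. reflexivity.
    + intros x y [-> | [X HXC Hx]].
      { rewrite imp_one_l. trivial. }
      intros [E | [Y HYC Hy]].
      { destruct (HC X HXC) as [[H1 Hmp] _].
        destruct (Hmp x y) as [E' | Hy].
        - right. exact Hx.
        - rewrite E. exact H1.
        - left. exact E'.
        - right. exists X; assumption. }
      destruct (Htot X Y HXC HYC) as [Hle | Hle].
      * destruct (HC Y HYC) as [[_ Hmp] _].
        destruct (Hmp x y) as [E | Hz].
        -- right. apply Hle, Hx.
        -- right. exact Hy.
        -- left. exact E.
        -- right. exists Y; assumption.
      * destruct (HC X HXC) as [[_ Hmp] _].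
        destruct (Hmp x y) as [E | Hz].
        -- right. exact Hx.
        -- right. apply Hle, Hy.
        -- left. exact E.
        -- right. exists X; assumption.
    + intros [X HXC Hx]. apply (proj2 (HC X HXC)), Hx.
  - exists (with_one X). split; [exact HF |]. split; [intros [E | E]; auto |].
    assert (Hadj : forall x, ~ with_one X x -> exists n, with_one X (impn n x g)).
    { intros x Hx. apply NNPP. intros Hn.
      apply (Hmax (adjoin (with_one X) x)).
      - split.
        + intros y Hy. exists O. right. exact Hy.
        + intros Hsub. apply Hx. right. apply Hsub. exists 1%nat. cbn.
          left. apply le_refl.
      - split; [| exact Hn].
        assert (Hf := adjoin_filter _ x HF).
        split; [left; reflexivity |].
        intros y z Hy Hz. right. apply (proj2 Hf) with y.
        + destruct Hy as [-> | Hy]; [apply Hf | exact Hy].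
        + destruct Hz as [-> | Hz]; [apply Hf | exact Hz]. }
    intros x y. apply NNPP. intros Hn. apply not_or_and in Hn. destruct Hn as [H1 H2].
    destruct (Hadj _ H1) as [m Hm]. destruct (Hadj _ H2) as [n Hn].
    destruct (filter_join_impn (with_one X) (x ~> y) (y ~> x) m n g); auto.
    rewrite prelinear. apply le_refl.
Qed.

End Filters.

(** * The evaluation attached to a prime filter *)

Section Evaluation.
Context {A : delta_algebra}.
Open Scope delta_scope.
Implicit Types x y z : A.

Fixpoint unit_frac (n : nat) : A :=
  match n with O => one | S n' => halve (unit_frac n') end.

Lemma unit_frac_mul2 k n : mul k (unit_frac n) = mul (k * 2) (unit_frac (S n)).
Proof.
  rewrite mulM. f_equal. cbn. rewrite (addC _ (~~ one)), add0, halve_add. reflexivity.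
Qed.

Lemma unit_frac_scale k n m :
  mul k (unit_frac n) = mul (k * 2 ^ m) (unit_frac (n + m)).
Proof.
  induction m as [|m IH].
  - rewrite Nat.add_0_r. f_equal. cbn. lia.
  - rewrite IH, unit_frac_mul2. rewrite Nat.add_succ_r. f_equal. cbn. lia.
Qed.

Lemma unit_frac_full n k : (2 ^ n <= k)%nat -> mul k (unit_frac n) = one.
Proof.
  intros H.
  assert (E : mul (2 ^ n) (unit_frac n) = one).
  { generalize (unit_frac_scale 1 0 n). rewrite mul1, Nat.mul_1_l.
    intros E. symmetry. exact E. }
  apply imp_antisym; [apply le_one |]. rewrite <- E at 1. apply mul_le, H.
Qed.

(** Induction through 1 - u/2 = u/2 + (1 - u), where u = 1/2^n, together with 2^(n+1) - 1 = 1 +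
    2(2^n - 1). *)
Lemma unit_frac_neg n : mul (2 ^ n - 1) (unit_frac n) = ~~ unit_frac n.
Proof.
  induction n as [|n IH]; [reflexivity |].
  replace (2 ^ S n - 1)%nat with (1 + (2 ^ n - 1) * 2)%nat.
  - rewrite mulD, <- unit_frac_mul2, IH, mul1. cbn [unit_frac].
    rewrite addC, negK. rewrite <- (sub_halve (unit_frac n)) at 2.
    rewrite negK. reflexivity.
  - cbn. generalize (Nat.pow_nonzero 2 n). lia.
Qed.

Lemma unit_frac_compl n k : (k <= 2 ^ n)%nat ->
  ~~ mul k (unit_frac n) = mul (2 ^ n - k) (unit_frac n).
Proof.
  induction k as [|k IH]; intros Hk.
  - cbn [mul]. rewrite negK, Nat.sub_0_r, unit_frac_full by lia. reflexivity.
  - cbn [mul]. rewrite addC, IH by lia.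
    replace (2 ^ n - k)%nat with (S (2 ^ n - S k)) by lia. cbn [mul].
    rewrite addC. apply addK. rewrite <- unit_frac_neg. apply mul_le. lia.
Qed.

Lemma unit_frac_imp n k l : (k <= 2 ^ n)%nat ->
  mul k (unit_frac n) ~> mul l (unit_frac n) = mul (2 ^ n - k + l) (unit_frac n).
Proof.
  intros Hk. rewrite imp_add, unit_frac_compl, mulD by exact Hk. reflexivity.
Qed.

Context (F : A -> Prop) (HF : is_filter F) (F0 : ~ F (~~ one))
  (Ftot : forall x y, F (x ~> y) \/ F (y ~> x)).

(** Otherwise [unit_frac n] would be zero modulo [F], and so would its multiple by [2 ^ n], which is
    [one]. *)
Lemma unit_frac_neg_notin n : ~ F (~~ unit_frac n).
Proof.
  intros H. rewrite negE in H.
  assert (Hk : forall k, F (mul k (unit_frac n) ~> ~~ one)).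
  { induction k as [|k IH]; cbn [mul].
    - rewrite le_refl. apply HF.
    - apply filter_trans with (mul k (unit_frac n)); [exact HF | | exact IH].
      rewrite <- (add0 (mul k (unit_frac n))) at 2.
      revert H. apply filter_up; [exact HF |].
      rewrite <- (contra (~~ one) (unit_frac n)). apply imp_comp. }
  specialize (Hk (2 ^ n)%nat). rewrite unit_frac_full, imp_one_l in Hk by lia.
  exact (F0 Hk).
Qed.

(** If l < k, the implication has the value 1 - (k - l)/2^n, which lies below [~~ unit_frac n], an
    element outside [F]. *)
Lemma mul_unit_frac_le n k l : (k <= 2 ^ n)%nat ->
  F (mul k (unit_frac n) ~> mul l (unit_frac n)) -> (k <= l)%nat.
Proof.
  intros Hk H. destruct (Compare_dec.le_lt_dec k l) as [Hle | Hlt]; [exact Hle | exfalso].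
  rewrite unit_frac_imp in H by exact Hk.
  apply (unit_frac_neg_notin n). rewrite <- unit_frac_neg.
  revert H. apply filter_up; [exact HF |]. apply mul_le. lia.
Qed.

Lemma mul_unit_frac_le_frac n m k l : (k <= 2 ^ n)%nat ->
  F (mul k (unit_frac n) ~> mul l (unit_frac m)) ->
  INR k / 2 ^ n <= INR l / 2 ^ m.
Proof.
  intros Hk H.
  rewrite (unit_frac_scale k n m), (unit_frac_scale l m n), (Nat.add_comm m n) in H.
  apply mul_unit_frac_le in H.
  - apply le_INR in H. rewrite !mult_INR, !pow_INR in H.
    replace (INR 2) with 2 in H by (cbn; lra).
    assert (0 < 2 ^ n) by (apply pow_lt; lra).
    assert (0 < 2 ^ m) by (apply pow_lt; lra).
    apply Rmult_le_reg_r with (2 ^ n * 2 ^ m); [nra |].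
    field_simplify; lra.
  - rewrite Nat.pow_add_r. apply Nat.mul_le_mono_r, Hk.
Qed.

(** Beyond [2 ^ n] the multiples are truncated to [one] while k/2^n keeps growing; the bound on [k]
    keeps the cut bounded when [x] is in [F]. *)
Definition lower_cut x (r : R) : Prop :=
  exists n k, (k <= 2 ^ n)%nat /\ F (mul k (unit_frac n) ~> x) /\ r = INR k / 2 ^ n.

Lemma lower_cut_bound x : bound (lower_cut x).
Proof.
  exists 1. intros r (n & k & Hk & _ & ->).
  apply le_INR in Hk. rewrite pow_INR in Hk. replace (INR 2) with 2 in Hk by (cbn; lra).
  assert (0 < 2 ^ n) by (apply pow_lt; lra).
  apply Rmult_le_reg_r with (2 ^ n); [assumption |]. field_simplify; lra.
Qed.

Lemma lower_cut_inhabited x : exists r, lower_cut x r.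
Proof.
  exists (INR 0 / 2 ^ 0), O, O. split; [lia |]. split; [| reflexivity].
  cbn [mul]. rewrite neg_one_le. apply HF.
Qed.

Definition eval x : R :=
  proj1_sig (completeness (lower_cut x) (lower_cut_bound x) (lower_cut_inhabited x)).

Lemma eval_lub x : is_lub (lower_cut x) (eval x).
Proof. exact (proj2_sig (completeness _ _ _)). Qed.

Lemma eval_ge x n k : (k <= 2 ^ n)%nat -> F (mul k (unit_frac n) ~> x) ->
  INR k / 2 ^ n <= eval x.
Proof. intros Hk H. apply (eval_lub x). exists n, k. auto. Qed.

Lemma eval_le x n k : F (x ~> mul k (unit_frac n)) -> eval x <= INR k / 2 ^ n.
Proof.
  intros H. apply (eval_lub x). intros r (m & l & Hl & Hlx & ->).
  apply mul_unit_frac_le_frac; [exact Hl |].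
  apply filter_trans with x; assumption.
Qed.

(** Totality of [F] compares [x] with each dyadic of level [n], and the bracket lies where the
    comparison first turns over. If it never does so below [one], the last interval works because
    its upper end is [one]. *)
Lemma eval_bracket x n : exists k, (k < 2 ^ n)%nat /\
  F (mul k (unit_frac n) ~> x) /\ F (x ~> mul (S k) (unit_frac n)).
Proof.
  assert (H : forall j, (j <= 2 ^ n)%nat ->
    F (mul j (unit_frac n) ~> x) \/ exists k, (k < 2 ^ n)%nat /\
      F (mul k (unit_frac n) ~> x) /\ F (x ~> mul (S k) (unit_frac n))).
  { induction j as [|j IH]; intros Hj.
    - left. cbn [mul]. rewrite neg_one_le. apply HF.
    - destruct IH as [IH | IH]; [lia | | right; exact IH].
      destruct (Ftot (mul (S j) (unit_frac n)) x) as [H | H]; [left; exact H |].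
      right. exists j. repeat split; [lia | exact IH | exact H]. }
  assert (Hpos := Nat.pow_nonzero 2 n).
  destruct (H (2 ^ n - 1)%nat) as [H1 | H1]; [lia | | exact H1].
  exists (2 ^ n - 1)%nat. split; [lia |]. split; [exact H1 |].
  rewrite unit_frac_full, le_one by lia. apply HF.
Qed.

Lemma eval_range x : 0 <= eval x <= 1.
Proof.
  split.
  - replace 0 with (INR 0 / 2 ^ 0) by (cbn; lra). apply eval_ge; [lia |].
    cbn [mul]. rewrite neg_one_le. apply HF.
  - replace 1 with (INR 1 / 2 ^ 0) by (cbn; lra). apply eval_le.
    rewrite mul1. cbn [unit_frac]. rewrite le_one. apply HF.
Qed.

Lemma small_pow2 (e : R) : (forall n, e <= 2 / 2 ^ n) -> e <= 0.
Proof.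
  intros H. destruct (Rle_or_lt e 0) as [Hle | Hlt]; [exact Hle | exfalso].
  destruct (pow_lt_1_zero (/ 2)) with (y := e / 2) as [N HN].
  - rewrite Rabs_pos_eq; lra.
  - lra.
  - specialize (HN N (Nat.le_refl N)). specialize (H N).
    rewrite pow_inv, Rabs_pos_eq in HN; [lra |].
    left. apply Rinv_0_lt_compat, pow_lt. lra.
Qed.

(** Brackets of width 1/2^n around [x] and [y] give dyadic bounds for [x ~> y], since implication is
    antitone on the left and monotone on the right. The two sides thus differ by at most 2/2^n for
    every [n]. *)
Lemma eval_imp x y : eval (x ~> y) = Rmin 1 (1 - eval x + eval y).
Proof.
  assert (B : forall n,
    eval (x ~> y) - Rmin 1 (1 - eval x + eval y) <= 2 / 2 ^ n /\
    Rmin 1 (1 - eval x + eval y) - eval (x ~> y) <= 2 / 2 ^ n).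
  { intros n.
    destruct (eval_bracket x n) as (k & Hk & Hx1 & Hx2).
    destruct (eval_bracket y n) as (l & Hl & Hy1 & Hy2).
    assert (U : F ((x ~> y) ~> mul (2 ^ n - k + S l) (unit_frac n))).
    { rewrite <- unit_frac_imp by lia.
      apply filter_trans with (mul k (unit_frac n) ~> y); [exact HF | |].
      - revert Hx1. apply filter_up; [exact HF | apply imp_comp].
      - revert Hy2. apply filter_up; [exact HF | apply imp_comp_r]. }
    assert (L : F (mul (2 ^ n - S k + l) (unit_frac n) ~> (x ~> y))).
    { rewrite <- unit_frac_imp by lia.
      apply filter_trans with (mul (S k) (unit_frac n) ~> y); [exact HF | |].
      - revert Hy1. apply filter_up; [exact HF | apply imp_comp_r].
      - revert Hx2. apply filter_up; [exact HF | apply imp_comp]. }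
    apply eval_le in U.
    (* The lower index may exceed [2 ^ n]; the multiple is then [one], and only the bound 1 can be
       claimed. *)
    assert (L' : Rmin 1 (INR (2 ^ n - S k + l) / 2 ^ n) <= eval (x ~> y)).
    { destruct (Compare_dec.le_lt_dec (2 ^ n - S k + l) (2 ^ n)) as [Hle | Hlt].
      - apply Rle_trans with (1 := Rmin_r _ _). apply eval_ge; assumption.
      - apply Rle_trans with (1 := Rmin_l _ _).
        replace 1 with (INR 1 / 2 ^ 0) by (cbn; lra). apply eval_ge; [cbn; lia |].
        rewrite unit_frac_full in L by lia. rewrite mul1. exact L. }
    apply eval_ge in Hx1; [| lia]. apply eval_le in Hx2.
    apply eval_ge in Hy1; [| lia]. apply eval_le in Hy2.
    assert (R0 := proj2 (eval_range (x ~> y))).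
    rewrite !plus_INR, !minus_INR, !S_INR, !pow_INR in * by lia.
    replace (INR 2) with 2 in * by (cbn; lra).
    assert (P : 0 < 2 ^ n) by (apply pow_lt; lra).
    set (d := / 2 ^ n).
    assert (Hd : 2 ^ n * d = 1) by (unfold d; field; lra).
    unfold Rdiv in *. fold d in U, L', Hx1, Hx2, Hy1, Hy2 |- *.
    assert (0 < d) by (apply Rinv_0_lt_compat; exact P).
    assert (E1 : (2 ^ n - INR k + (INR l + 1)) * d = 1 - INR k * d + INR l * d + d)
      by (ring_simplify; lra).
    assert (E2 : (2 ^ n - (INR k + 1) + INR l) * d = 1 - INR k * d + INR l * d - d)
      by (ring_simplify; lra).
    rewrite E1 in U. rewrite E2 in L'.
    revert L'. unfold Rmin. destruct Rle_dec; destruct Rle_dec; intros L'; lra. }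
  assert (L1 := small_pow2 _ (fun n => proj1 (B n))).
  assert (L2 := small_pow2 _ (fun n => proj2 (B n))).
  lra.
Qed.

Lemma eval_zero : eval (~~ one) = 0.
Proof.
  apply Rle_antisym; [| apply eval_range].
  replace 0 with (INR 0 / 2 ^ 0) by (cbn; lra). apply eval_le.
  cbn [mul]. rewrite le_refl. apply HF.
Qed.

Lemma eval_neg x : eval (~~ x) = 1 - eval x.
Proof.
  rewrite negE, eval_imp, eval_zero. assert (H := eval_range x).
  rewrite Rmin_right; lra.
Qed.

Lemma eval_mono x y : F (x ~> y) -> eval x <= eval y.
Proof.
  intros H. apply (eval_lub x). intros r (n & k & Hk & Hkx & ->).
  apply eval_ge; [exact Hk |]. apply filter_trans with x; assumption.
Qed.

Lemma eval_sub x y : y <<= x -> eval (~~ (x ~> y)) = eval x - eval y.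
Proof.
  intros H. rewrite eval_neg, eval_imp.
  assert (eval y <= eval x) by (apply eval_mono; rewrite H; apply HF).
  rewrite Rmin_right; lra.
Qed.

Lemma eval_halve x : eval (halve x) = eval x / 2.
Proof.
  assert (H := eval_sub x (halve x) (halve_le x)). rewrite sub_halve in H. lra.
Qed.

(** The tail law read in the reals; the subtraction in it is exact because
    [halve (s O) <<= delta s]. *)
Lemma eval_delta_step (s : nat -> A) :
  eval (delta s) = eval (s O) / 2 + eval (delta (fun k => s (S k))) / 2.
Proof.
  assert (H := eval_sub _ _ (halve_le_delta s)).
  rewrite delta_tail, !eval_halve in H. lra.
Qed.

Lemma eval_delta (s : nat -> A) :
  infinite_sum (fun k => eval (s k) / 2 ^ S k) (eval (delta s)).
Proof.
  (* Iterating the step leaves an explicit remainder. The partial sum up to index [n] has [n + 1]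
     terms, hence the shift by [S n]; the remainder is at most 1/2^(n+1). *)
  assert (E : forall n, sum_f_R0 (fun k => eval (s k) / 2 ^ S k) n =
    eval (delta s) - eval (delta (fun k => s (S n + k)%nat)) / 2 ^ S n).
  { induction n as [|n IH].
    - cbn [sum_f_R0]. rewrite (eval_delta_step s). cbn. field.
    - cbn [sum_f_R0]. rewrite IH, (eval_delta_step (fun k => s (S n + k)%nat)).
      rewrite Nat.add_0_r.
      replace (fun k => s (S n + S k)%nat) with (fun k => s (S (S n) + k)%nat)
        by (extensionality k; f_equal; lia).
      cbn [pow]. field. apply pow_nonzero. lra. }
  intros e He.
  destruct (pow_lt_1_zero (/ 2)) with (y := e) as [N HN].
  - rewrite Rabs_pos_eq; lra.
  - exact He.
  - exists N. intros n Hn. unfold Rdist. rewrite E.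
    assert (R0 := eval_range (delta (fun k => s (S n + k)%nat))).
    set (t := eval (delta (fun k => s (S n + k)%nat))) in *.
    assert (P : 0 < / 2 ^ S n) by (apply Rinv_0_lt_compat, pow_lt; lra).
    specialize (HN (S n) ltac:(lia)). rewrite pow_inv, Rabs_pos_eq in HN by lra.
    replace (eval (delta s) - t / 2 ^ S n - eval (delta s)) with (- (t * / 2 ^ S n))
      by (unfold Rdiv; ring).
    rewrite Rabs_Ropp, Rabs_pos_eq; nra.
Qed.

Lemma eval_mul n x : eval (mul n x) <= INR n * eval x.
Proof.
  induction n as [|n IH].
  - cbn [mul]. rewrite eval_zero. cbn. lra.
  - cbn [mul]. rewrite eval_imp, eval_neg, S_INR.
    apply Rle_trans with (1 := Rmin_r _ _). lra.
Qed.

End Evaluation.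

(** * Separation by maps to the unit interval *)

Theorem delta_algebra_separation (A : delta_algebra) (a : A) :
  a <> one ->
  exists v : A -> R,
    (forall x, 0 <= v x <= 1) /\
    (forall x, v (neg x) = 1 - v x) /\
    (forall x y, v (imp x y) = Rmin 1 (1 - v x + v y)) /\
    (forall s, infinite_sum (fun k => v (s k) / 2 ^ S k) (v (delta s))) /\
    v a < 1.
Proof.
  intros Ha.
  assert (Hm : exists m, imp (mul m (neg a)) a <> one).
  { apply NNPP. intros Hn. apply Ha.
    rewrite <- (negK a), (archimedean (neg a)); [apply negK |].
    intros m. rewrite negK. apply NNPP. intros H. apply Hn. exists m. exact H. }
  destruct Hm as [m Hm].
  destruct (prime_filter_exists _ Hm) as (F & HF & Hg & Ftot).
  assert (F0 : ~ F (neg one)).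
  { intros H. apply Hg. revert H. apply filter_up; [exact HF | apply neg_one_le]. }
  exists (eval F HF).
  split; [apply eval_range; assumption |].
  split; [apply eval_neg; assumption |].
  split; [apply eval_imp; assumption |].
  split; [apply eval_delta; assumption |].
  destruct (Ftot (mul m (neg a)) a) as [H | H]; [contradiction |].
  apply eval_mono with (HF := HF) in H.
  assert (H1 := eval_mul F HF F0 Ftot m (neg a)).
  rewrite eval_neg in H1 by assumption.
  assert (H2 := eval_range F HF F0 a).
  destruct (Req_dec (eval F HF a) 1) as [E | E]; [rewrite E in *; nra | lra].
Qed.

(** * Soundness *)

Lemma is_series_ext_R (x y : nat -> R) (l : R) :
  (forall k, x k = y k) -> is_series x l -> is_series y l.
Proof. apply is_series_ext. Qed.

Lemma is_series_scal_R (c : R) (x : nat -> R) (l : R) :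
  is_series x l -> is_series (fun k => c * x k) (c * l).
Proof. exact (is_series_scal_l c x l). Qed.

Lemma is_series_le (x y : nat -> R) (X Y : R) :
  (forall k, x k <= y k) -> is_series x X -> is_series y Y -> X <= Y.
Proof.
  intros H HX HY.
  assert (E : Rbar_le X Y); [| exact E].
  apply is_lim_seq_le with (sum_n x) (sum_n y); [| exact HX | exact HY].
  intros n. apply sum_n_m_le, H.
Qed.

(** The weights of [Delta] sum to 1, which supplies the constant in [val_delta_imp]. *)
Lemma geom_half : is_series (fun k => 1 / 2 ^ S k) 1.
Proof.
  assert (H : is_series (fun k => (/ 2) ^ k) (/ (1 - / 2)))
    by (apply is_series_geom; rewrite Rabs_pos_eq; lra).
  apply (is_series_scal_R (/ 2)) in H.
  replace (/ 2 * / (1 - / 2)) with 1 in H by field.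
  revert H. apply is_series_ext_R.
  intros k. rewrite pow_inv. cbn [pow]. field. apply pow_nonzero. lra.
Qed.

Section Soundness.
Context (v : Form -> R) (Hv : is_valuation v).

Lemma val_range a : 0 <= v a <= 1.
Proof. apply Hv. Qed.

Lemma val_neg a : v (Neg a) = 1 - v a.
Proof. apply Hv. Qed.

Lemma val_imp a b : v (Imp a b) = Rmin 1 (1 - v a + v b).
Proof. apply Hv. Qed.

Lemma val_delta s : is_series (fun k => v (s k) / 2 ^ S k) (v (Delta s)).
Proof. apply is_series_Reals, Hv. Qed.

Lemma val_imp_one a b : v (Imp a b) = 1 <-> v a <= v b.
Proof.
  rewrite val_imp. unfold Rmin. destruct Rle_dec; split; lra.
Qed.

Lemma val_delta_step s : v (Delta s) = v (s O) / 2 + v (Delta (stail s)) / 2.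
Proof.
  rewrite <- (is_series_unique _ _ (val_delta s)).
  apply is_series_unique, is_series_decr_1.
  change (is_series (fun k => v (s (S k)) / 2 ^ S (S k))
    (v (s O) / 2 + v (Delta (stail s)) / 2 + - (v (s O) / 2 ^ 1))).
  assert (E : v (s O) / 2 + v (Delta (stail s)) / 2 + - (v (s O) / 2 ^ 1) =
    / 2 * v (Delta (stail s))) by field.
  rewrite E.
  apply is_series_ext_R with (fun k => / 2 * (v (stail s k) / 2 ^ S k)).
  - intros k. unfold stail. cbn [pow]. field. apply pow_nonzero. lra.
  - apply is_series_scal_R, val_delta.
Qed.

(** A constant sequence is its own tail, so its value d satisfies d = v(a)/2 + d/2. *)
Lemma val_delta_cst a : v (Delta (cst a)) = v a.
Proof.
  assert (H := val_delta_step (cst a)).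
  change (stail (cst a)) with (cst a) in H. unfold cst at 2 in H. lra.
Qed.

Lemma val_half a : v (half a) = v a / 2.
Proof.
  unfold half. rewrite val_delta_step.
  change (stail _) with (cst (bot_of a)). rewrite val_delta_cst. cbn [scons].
  unfold bot_of. rewrite val_neg.
  replace (v (Imp a a)) with 1 by (symmetry; apply val_imp_one; lra). lra.
Qed.

Lemma val_delta_le s t : (forall k, v (s k) <= v (t k)) -> v (Delta s) <= v (Delta t).
Proof.
  intros H. apply (is_series_le _ _ _ _) with (2 := val_delta s) (3 := val_delta t).
  intros k. apply Rmult_le_compat_r; [| apply H].
  left. apply Rinv_0_lt_compat, pow_lt. lra.
Qed.

Lemma val_delta_halve s : v (Delta (fun k => half (s k))) = v (Delta s) / 2.
Proof.
  rewrite <- (is_series_unique _ _ (val_delta (fun k => half (s k)))).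
  apply is_series_unique.
  replace (v (Delta s) / 2) with (/ 2 * v (Delta s)) by field.
  apply is_series_ext_R with (fun k => / 2 * (v (s k) / 2 ^ S k)).
  - intros k. rewrite val_half. field. apply pow_nonzero. lra.
  - apply is_series_scal_R, val_delta.
Qed.

(** Termwise, v(s_k -> t_k) + v(s_k) is at most 1 + v(t_k); these inequalities are summed with the
    weights 1/2^(k+1). *)
Lemma val_delta_imp s t :
  v (Delta (fun k => Imp (s k) (t k))) + v (Delta s) <= 1 + v (Delta t).
Proof.
  apply (is_series_le _ _ _ _) with
    (2 := is_series_plus _ _ _ _ (val_delta (fun k => Imp (s k) (t k))) (val_delta s))
    (3 := is_series_plus _ _ _ _ geom_half (val_delta t)).
  intros k. unfold plus. cbn [AbelianMonoid.plus]. cbn -[pow].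
  rewrite <- !Rdiv_plus_distr. apply Rmult_le_compat_r.
  - left. apply Rinv_0_lt_compat, pow_lt. lra.
  - rewrite val_imp. generalize (Rmin_r 1 (1 - v (s k) + v (t k))). lra.
Qed.

(** Every schema is an implication, so each case becomes an inequality between two values. *)
Lemma axiom_sound a : LAxiom a -> v a = 1.
Proof.
  destruct 1 as [a b | a b c | a b | a b | s | s | s | s | a | a | a s | a s
                | s t | a b | a b | s t];
    apply val_imp_one.
  - rewrite val_imp. generalize (val_range a) (val_range b).
    unfold Rmin; destruct Rle_dec; lra.
  - rewrite !val_imp. generalize (val_range a) (val_range b) (val_range c).
    unfold Rmin; repeat destruct Rle_dec; lra.
  - rewrite !val_imp. generalize (val_range a) (val_range b).
    unfold Rmin; repeat destruct Rle_dec; lra.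
  - rewrite !val_imp, !val_neg. unfold Rmin; repeat destruct Rle_dec; lra.
  - rewrite val_neg, val_imp, !val_half, (val_delta_step s).
    generalize (val_range (Delta (stail s))). unfold Rmin; destruct Rle_dec; lra.
  - rewrite val_neg, val_imp, !val_half, (val_delta_step s).
    generalize (val_range (Delta (stail s))). unfold Rmin; destruct Rle_dec; lra.
  - rewrite val_half, val_delta_halve. lra.
  - rewrite val_half, val_delta_halve. lra.
  - rewrite val_delta_cst. lra.
  - rewrite val_delta_cst. lra.
  - rewrite val_half, (val_delta_step (scons _ _)).
    change (stail (scons _ s)) with s. generalize (val_range (bot_of a)). cbn [scons]. lra.
  - rewrite val_half, (val_delta_step (scons _ _)).
    change (stail (scons _ s)) with s. cbn [scons]. unfold bot_of. rewrite val_neg.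
    replace (v (Imp a a)) with 1 by (symmetry; apply val_imp_one; lra). lra.
  - apply val_delta_le. intros k. rewrite val_imp, val_neg.
    generalize (val_range (s k)) (val_range (t k)). unfold Rmin; destruct Rle_dec; lra.
  - rewrite val_half, !val_neg, !val_imp, !val_half.
    unfold Rmin; repeat destruct Rle_dec; lra.
  - rewrite val_half, !val_neg, !val_imp, !val_half.
    unfold Rmin; repeat destruct Rle_dec; lra.
  - rewrite val_imp. generalize (val_delta_imp s t).
    generalize (val_range (Delta (fun k => Imp (s k) (t k)))).
    unfold Rmin; destruct Rle_dec; lra.
Qed.

End Soundness.

Lemma soundness Th a : provable Th a -> entails Th a.
Proof.
  intros (I & lt & top & seq & Hwf & _ & _ & _ & _ & <- & Hstep) v Hv HTh.
  generalize top. apply (well_founded_induction Hwf). intros i IH.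
  destruct (Hstep i) as [Hax | [Hth | [(j & k & Hj & Hk & E) | (s & E & Hs)]]].
  - apply axiom_sound; assumption.
  - apply HTh, Hth.
  - assert (H := IH k Hk). rewrite E in H. apply val_imp_one in H; [| exact Hv].
    rewrite (IH j Hj) in H. generalize (val_range v Hv (seq i)). lra.
  - rewrite E. apply Rle_antisym; [apply val_range; exact Hv |].
    (* The premise of index 0 has value 1, and so does its constant sequence under [Delta]; this
       bounds the conclusion from below. *)
    destruct (Hs O) as (j0 & Hj0 & E0).
    rewrite <- (IH j0 Hj0), <- (val_delta_cst v Hv (seq j0)).
    apply val_delta_le; [exact Hv |]. intros n. destruct (Hs n) as (j & Hj & Ej).
    unfold cst. rewrite <- Ej, (IH j0 Hj0), (IH j Hj). lra.
Qed.

(** * Derivability and transfinite proofs *)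

(** Derivations from no hypotheses as well-founded, infinitely branching trees. They are easier to
    build than transfinite sequences, and [derivable_provable] linearises them. *)
Inductive derivable : Form -> Prop :=
| der_axiom a : LAxiom a -> derivable a
| der_mp a b : derivable a -> derivable (Imp a b) -> derivable b
| der_delta s : (forall n, derivable (s n)) -> derivable (Delta s).

Lemma fun_choice (T : Type) (B : T -> Type) (P : forall x, B x -> Prop) :
  (forall x, exists y, P x y) -> exists f, forall x, P x (f x).
Proof.
  intros H. exists (fun x => proj1_sig (constructive_indefinite_description _ (H x))).
  intros x. exact (proj2_sig (constructive_indefinite_description _ (H x))).
Qed.

Section OmegaSum.
Context (I : nat -> Type) (lt : forall n, I n -> I n -> Prop).

(** The ordinal sum of the orders [I n] along omega, with [None] as a new greatest element. *)
Definition sum_lt (x y : option {n : nat & I n}) : Prop :=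
  match x, y with
  | Some x, Some y => lexprod nat I Nat.lt lt x y
  | Some _, None => True
  | None, _ => False
  end.

Lemma lexprod_same n i j :
  lexprod nat I Nat.lt lt (existT _ n i) (existT _ n j) -> lt n i j.
Proof.
  inversion 1 as [? ? ? ? Hlt | ? ? ? Hlt].
  - exfalso. revert Hlt. apply Nat.lt_irrefl.
  - repeat match goal with E : existT _ _ _ = existT _ _ _ |- _ =>
      apply inj_pair2_eq_dec in E; [subst | apply Nat.eq_dec] end.
    exact Hlt.
Qed.

Lemma sum_lt_wf : (forall n, well_founded (lt n)) -> well_founded sum_lt.
Proof.
  intros H.
  assert (HS : forall x, Acc sum_lt (Some x)).
  { apply (well_founded_induction (wf_lexprod nat I Nat.lt lt Nat.lt_wf_0 H)).
    intros x IH. constructor. intros [y|] Hy; [apply IH, Hy | destruct Hy]. }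
  intros [x|]; [apply HS |].
  constructor. intros [y|] Hy; [apply HS | destruct Hy].
Qed.

Lemma sum_lt_trans : (forall n i j k, lt n i j -> lt n j k -> lt n i k) ->
  forall x y z, sum_lt x y -> sum_lt y z -> sum_lt x z.
Proof.
  intros H [[n x]|] [[m y]|] [[l z]|]; cbn; try tauto.
  intros Hxy Hyz.
  assert (Hnm : (n <= m)%nat) by (inversion Hxy; subst; [apply Nat.lt_le_incl |]; auto).
  assert (Hml : (m <= l)%nat) by (inversion Hyz; subst; [apply Nat.lt_le_incl |]; auto).
  destruct (Nat.eq_dec n l) as [-> | Hne].
  - assert (m = l) by lia. subst m. right.
    apply H with y; apply lexprod_same; assumption.
  - left. unfold Nat.lt. lia.
Qed.

Lemma sum_lt_total : (forall n i j, lt n i j \/ i = j \/ lt n j i) ->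
  forall x y, sum_lt x y \/ x = y \/ sum_lt y x.
Proof.
  intros H [[n x]|] [[m y]|]; cbn; auto.
  destruct (Nat.lt_trichotomy n m) as [Hlt | [-> | Hlt]].
  - left. left. exact Hlt.
  - destruct (H m x y) as [Hlt | [-> | Hlt]]; auto using right_lex.
  - right. right. left. exact Hlt.
Qed.

Lemma sum_countable : (forall n, exists f : I n -> nat, forall i j, f i = f j -> i = j) ->
  exists f : option {n : nat & I n} -> nat, forall x y, f x = f y -> x = y.
Proof.
  intros H. apply fun_choice in H. destruct H as [f Hf].
  exists (fun x => match x with
    | Some x => S (Cantor.to_nat (projT1 x, f _ (projT2 x))) | None => O end).
  intros [[n x]|] [[m y]|]; intros E; try discriminate; [| reflexivity].
  apply eq_add_S, Cantor.to_nat_inj in E. injection E as -> E.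
  apply Hf in E. subst. reflexivity.
Qed.

End OmegaSum.

(* The proofs of the [b n] are concatenated in order type omega, with [c] on top. *)
Lemma provable_concat Th (b : nat -> Form) c :
  (forall n, provable Th (b n)) ->
  (exists m n, b n = Imp (b m) c) \/ c = Delta b ->
  provable Th c.
Proof.
  intros Hb Hc. unfold provable in Hb.
  apply fun_choice in Hb. destruct Hb as [I Hb].
  apply fun_choice in Hb. destruct Hb as [lt Hb].
  apply fun_choice in Hb. destruct Hb as [top Hb].
  apply fun_choice in Hb. destruct Hb as [seq Hb].
  exists (option {n : nat & I n}), (sum_lt I lt), None,
    (fun x => match x with Some x => seq _ (projT2 x) | None => c end).
  split; [apply sum_lt_wf; intros n; apply (Hb n) |].
  split; [apply sum_lt_trans; intros n; apply (Hb n) |].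
  split; [apply sum_lt_total; intros n; apply (Hb n) |].
  split; [apply sum_countable; intros n; apply (Hb n) |].
  split; [intros [x|] Hx; [exact Logic.I | congruence] |].
  split; [reflexivity |].
  assert (Htop : forall n, seq n (top n) = b n) by (intros n; apply (Hb n)).
  intros [[n i]|].
  - destruct (Hb n) as (_ & _ & _ & _ & _ & _ & Hstep).
    destruct (Hstep i) as [Hax | [Hth | [(j & k & Hj & Hk & E) | (s & E & Hs)]]].
    + left. exact Hax.
    + right. left. exact Hth.
    + right. right. left. exists (Some (existT _ n j)), (Some (existT _ n k)).
      repeat split; [right; exact Hj | right; exact Hk | exact E].
    + right. right. right. exists s. split; [exact E |]. intros m.
      destruct (Hs m) as (j & Hj & Ej). exists (Some (existT _ n j)).
      split; [right; exact Hj | exact Ej].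
  - destruct Hc as [(m & n & E) | ->].
    + right. right. left.
      exists (Some (existT _ m (top m))), (Some (existT _ n (top n))).
      repeat split. rewrite !Htop. exact E.
    + right. right. right. exists b. split; [reflexivity |]. intros n.
      exists (Some (existT _ n (top n))). split; [exact Logic.I | apply Htop].
Qed.

Lemma derivable_provable a : derivable a -> provable (fun _ => False) a.
Proof.
  induction 1 as [a Ha | a b _ IHa _ IHab | s _ IHs].
  - exists unit, (fun _ _ => False), tt, (fun _ => a).
    split; [intros i; constructor; tauto |].
    split; [tauto |].
    split; [intros [] []; auto |].
    split; [exists (fun _ => O); intros [] []; reflexivity |].
    split; [intros [] H; congruence |].
    split; [reflexivity | auto].
  (* The two premises of modus ponens are padded to an omega-sequence by repeating [Imp a b]. *)
  - apply (provable_concat _ (fun n => match n with O => a | S _ => Imp a b end)).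
    + intros [|n]; assumption.
    + left. exists 0%nat, 1%nat. reflexivity.
  - apply (provable_concat _ s); [exact IHs | right; reflexivity].
Qed.

(** * Derived rules of the calculus *)

Lemma der_const a b : derivable a -> derivable (Imp b a).
Proof. intros H. apply der_mp with a; [exact H | apply der_axiom, L1]. Qed.

Lemma der_trans a b c : derivable (Imp a b) -> derivable (Imp b c) -> derivable (Imp a c).
Proof.
  intros Hab Hbc. apply der_mp with (Imp b c); [exact Hbc |].
  apply der_mp with (Imp a b); [exact Hab | apply der_axiom, L2].
Qed.

(** By L3 it suffices to derive [Imp (Imp b a) a], a weakening of [a]. *)
Lemma der_discharge a b : derivable a -> derivable (Imp (Imp a b) b).
Proof.
  intros H. apply der_mp with (Imp (Imp b a) a); [apply der_const, H |].
  apply der_axiom, L3.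
Qed.

(** An instance of L1, hence derivable at once; reflexivity of implication is then proved from
    it. *)
Definition verum : Form := Imp (Var 0) (Imp (Var 0) (Var 0)).

Lemma der_verum : derivable verum.
Proof. apply der_axiom, L1. Qed.

Lemma der_refl a : derivable (Imp a a).
Proof.
  apply der_trans with (Imp verum a); [apply der_axiom, L1 |].
  apply der_discharge, der_verum.
Qed.

Lemma der_imp_r a b c : derivable (Imp b c) -> derivable (Imp (Imp a b) (Imp a c)).
Proof.
  intros H. apply der_trans with (Imp (Imp b c) (Imp a c)); [apply der_axiom, L2 |].
  apply der_discharge, H.
Qed.

Lemma der_imp_l a b c : derivable (Imp a b) -> derivable (Imp (Imp b c) (Imp a c)).
Proof. intros H. apply der_mp with (Imp a b); [exact H | apply der_axiom, L2]. Qed.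

Lemma der_negK_l a : derivable (Imp (Neg (Neg a)) a).
Proof.
  apply der_trans with (Imp (Neg (Neg verum)) (Neg (Neg a))); [apply der_axiom, L1 |].
  apply der_trans with (Imp (Neg a) (Neg verum)); [apply der_axiom, L4 |].
  apply der_trans with (Imp verum a); [apply der_axiom, L4 |].
  apply der_discharge, der_verum.
Qed.

Lemma der_negK_r a : derivable (Imp a (Neg (Neg a))).
Proof.
  apply der_mp with (Imp (Neg (Neg (Neg a))) (Neg a)); [apply der_negK_l |].
  apply der_axiom, L4.
Qed.

Lemma der_neg a b : derivable (Imp a b) -> derivable (Imp (Neg b) (Neg a)).
Proof.
  intros H. apply der_mp with (Imp (Neg (Neg a)) (Neg (Neg b))); [| apply der_axiom, L4].
  apply der_trans with a; [apply der_negK_l |].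
  apply der_trans with b; [exact H | apply der_negK_r].
Qed.

Lemma der_delta_mono s t :
  (forall k, derivable (Imp (s k) (t k))) -> derivable (Imp (Delta s) (Delta t)).
Proof.
  intros H. apply der_mp with (Delta (fun k => Imp (s k) (t k))).
  - apply der_delta, H.
  - apply der_axiom, D7.
Qed.

(** * The Lindenbaum algebra *)

Definition equiv (a b : Form) : Prop := derivable (Imp a b) /\ derivable (Imp b a).

Lemma equiv_refl a : equiv a a.
Proof. split; apply der_refl. Qed.

Lemma equiv_sym a b : equiv a b -> equiv b a.
Proof. intros []. split; assumption. Qed.

Lemma equiv_trans a b c : equiv a b -> equiv b c -> equiv a c.
Proof. intros [] []. split; apply der_trans with b; assumption. Qed.

Lemma equiv_imp a a' b b' : equiv a a' -> equiv b b' -> equiv (Imp a b) (Imp a' b').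
Proof.
  intros [] []. split.
  - apply der_trans with (Imp a b'); [apply der_imp_r | apply der_imp_l]; assumption.
  - apply der_trans with (Imp a' b); [apply der_imp_r | apply der_imp_l]; assumption.
Qed.

Lemma equiv_neg a a' : equiv a a' -> equiv (Neg a) (Neg a').
Proof. intros []. split; apply der_neg; assumption. Qed.

Lemma equiv_delta s t : (forall k, equiv (s k) (t k)) -> equiv (Delta s) (Delta t).
Proof. intros H. split; apply der_delta_mono; apply H. Qed.

Lemma equiv_verum a : derivable a <-> equiv a verum.
Proof.
  split.
  - intros H. split; apply der_const; [apply der_verum | exact H].
  - intros [_ H]. apply der_mp with verum; [apply der_verum | exact H].
Qed.

Lemma equiv_half a b : equiv a b -> equiv (half a) (half b).
Proof.
  intros H. apply equiv_delta. intros [|k]; cbn; [exact H |].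
  apply equiv_neg, equiv_imp; exact H.
Qed.

(** The quotient is the type of equivalence classes as predicates, so provably equivalent formulas
    give equal elements and the algebra laws can be stated with plain equality. *)
Definition lindenbaum : Type := {P : Form -> Prop | exists a, P = equiv a}.

Definition cls (a : Form) : lindenbaum := exist _ (equiv a) (ex_intro _ a eq_refl).

Definition repr (x : lindenbaum) : Form :=
  proj1_sig (constructive_indefinite_description _ (proj2_sig x)).

Lemma cls_eq a b : cls a = cls b <-> equiv a b.
Proof.
  split.
  - intros H. apply (f_equal (@proj1_sig _ _)) in H. cbn in H.
    rewrite H. apply equiv_refl.
  - intros H. apply eq_sig_hprop; [intros; apply proof_irrelevance |]. cbn.
    extensionality c. apply propositional_extensionality.
    split; apply equiv_trans; [apply equiv_sym |]; exact H.
Qed.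

Lemma reprK x : cls (repr x) = x.
Proof.
  apply eq_sig_hprop; [intros; apply proof_irrelevance |]. cbn. symmetry.
  exact (proj2_sig (constructive_indefinite_description _ (proj2_sig x))).
Qed.

Lemma repr_cls a : equiv (repr (cls a)) a.
Proof. apply cls_eq, reprK. Qed.

Lemma cls_verum a : cls a = cls verum <-> derivable a.
Proof. rewrite cls_eq, equiv_verum. reflexivity. Qed.

(** The operations act on chosen representatives; the congruence properties of [equiv] make the
    choice immaterial, as [lind_impE] and its companions record. *)
Definition lind_imp (x y : lindenbaum) : lindenbaum := cls (Imp (repr x) (repr y)).
Definition lind_neg (x : lindenbaum) : lindenbaum := cls (Neg (repr x)).
Definition lind_delta (s : nat -> lindenbaum) : lindenbaum :=
  cls (Delta (fun k => repr (s k))).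
Definition lind_half (x : lindenbaum) : lindenbaum := cls (half (repr x)).

Lemma lind_impE a b : lind_imp (cls a) (cls b) = cls (Imp a b).
Proof. apply cls_eq, equiv_imp; apply repr_cls. Qed.

Lemma lind_negE a : lind_neg (cls a) = cls (Neg a).
Proof. apply cls_eq, equiv_neg, repr_cls. Qed.

Lemma lind_deltaE s : lind_delta (fun k => cls (s k)) = cls (Delta s).
Proof. apply cls_eq, equiv_delta. intros k. apply repr_cls. Qed.

Lemma lind_halfE a : lind_half (cls a) = cls (half a).
Proof. apply cls_eq, equiv_half, repr_cls. Qed.

Lemma lind_seq (s : nat -> lindenbaum) : exists t, s = (fun k => cls (t k)).
Proof. exists (fun k => repr (s k)). extensionality k. symmetry. apply reprK. Qed.

Definition lindenbaum_algebra : delta_algebra.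
Proof.
  refine {| carrier := lindenbaum; imp := lind_imp; neg := lind_neg;
    one := cls verum; delta := lind_delta; halve := lind_half |}.
  - intros x. rewrite <- (reprK x), lind_impE, !cls_verum. intros H.
    apply der_mp with verum; [apply der_verum | exact H].
  - intros x y. rewrite <- (reprK x), <- (reprK y), !lind_impE, !cls_verum, cls_eq.
    split; assumption.
  - intros x y. rewrite <- (reprK x), <- (reprK y), !lind_impE, cls_verum.
    apply der_axiom, L1.
  - intros x y z. rewrite <- (reprK x), <- (reprK y), <- (reprK z), !lind_impE, cls_verum.
    apply der_axiom, L2.
  - intros x y. rewrite <- (reprK x), <- (reprK y), !lind_impE, cls_verum.
    apply der_axiom, L3.
  - intros x y. rewrite <- (reprK x), <- (reprK y), !lind_negE, !lind_impE, cls_verum.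
    apply der_axiom, L4.
  - intros x. apply cls_eq, equiv_delta. intros [|k]; cbn; [apply equiv_refl |].
    (* The tails [bot_of (repr x)] and [neg one] agree because both negate derivable formulas. *)
    apply cls_eq. rewrite reprK, lind_negE. apply cls_eq.
    apply equiv_neg, equiv_verum, der_refl.
  - intros s. destruct (lind_seq s) as [t ->].
    rewrite !lind_deltaE, !lind_halfE, lind_impE, lind_negE. apply cls_eq.
    split; apply der_axiom; [apply D1a | apply D1b].
  - intros s. destruct (lind_seq s) as [t ->].
    rewrite lind_deltaE, lind_halfE.
    replace (fun k => lind_half (cls (t k))) with (fun k => cls (half (t k)))
      by (extensionality k; symmetry; apply lind_halfE).
    rewrite lind_deltaE. apply cls_eq.
    split; apply der_axiom; [apply D2a | apply D2b].
  - intros x. rewrite <- (reprK x), lind_deltaE. apply cls_eq.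
    split; apply der_axiom; [apply D3a | apply D3b].
  - intros x y. rewrite <- (reprK x), <- (reprK y).
    rewrite lind_impE, lind_negE, !lind_halfE, lind_impE, lind_negE. apply cls_eq.
    split; apply der_axiom; [apply D6a | apply D6b].
  - intros s t. destruct (lind_seq s) as [s' ->]. destruct (lind_seq t) as [t' ->].
    replace (fun k => lind_imp (cls (s' k)) (cls (t' k)))
      with (fun k => cls (Imp (s' k) (t' k)))
      by (extensionality k; symmetry; apply lind_impE).
    rewrite !lind_deltaE, !lind_impE, cls_verum. apply der_axiom, D7.
Defined.

(** * Completeness *)

Lemma completeness_derivable a : tautology a -> derivable a.
Proof.
  intros Ha. apply cls_verum. apply NNPP. intros Hn.
  destruct (delta_algebra_separation lindenbaum_algebra (cls a) Hn)
    as (v & Hrange & Hneg & Himp & Hdelta & Hlt).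
  apply Rlt_not_eq with (1 := Hlt).
  (* Since [cls] commutes with the connectives, pulling [v] back along it gives a valuation; at [a]
     its value is below 1. *)
  apply (Ha (fun b => v (cls b))); [| contradiction].
  split; [intros b; apply Hrange |].
  split; [intros b; rewrite <- lind_negE; apply Hneg |].
  split; [intros b c; rewrite <- lind_impE; apply Himp |].
  intros s. rewrite <- lind_deltaE. apply (Hdelta (fun k => cls (s k))).
Qed.

Theorem mainTheorem12 :
  forall a : Form, provable (fun _ => False) a <-> tautology a.
Proof.
  intros a. split.
  - apply soundness.
  - intros H. apply derivable_provable, completeness_derivable, H.
Qed.
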